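(* Let $W\subseteq\mathcal{L}_\Sigma$ be finite and $\varphi\in\mathcal{L}_\Sigma$. Let $D_W=\{\delta_p\mid p\in\mathit{var}(W)\}=\{\delta_1,\ldots,\delta_n\}$ with selector variables $G=\{g_1,\ldots,g_n\}$, $D_\varphi=\{\delta_p\mid p\in\mathit{var}(\varphi)\setminus\mathit{var}(W)\}$, $T=(D_W,W^\pm)$ and $T'=(D_W,W^\pm\cup c(D_\varphi))$. Let $G'=\{g'_1,\ldots,g'_n\}$ be further new variables, $\Psi=\bigwedge_{i=1}^n\big(\neg g'_i\to\exists G(\mathit{Ext}[T]\wedge\neg\mathit{Conseq}[T,c(\delta_i)])\big)$, and for any $\chi$ let $\mathit{Conseq}_{G\leftarrow G'}[T',\chi]$ be $\mathit{Conseq}[T',\chi]$ with each $g_i$ replaced by $g'_i$. Then (1) $W\vdash^\pm_c\varphi$ iff $\models\exists G(\mathit{Ext}[T]\wedge\mathit{Conseq}[T',\varphi^\pm])$; (2) $W\vdash^\pm_s\varphi$ iff $\models\neg\exists G(\mathit{Ext}[T]\wedge\neg\mathit{Conseq}[T',\varphi^\pm])$; (3) $W\vdash^\pm_p\varphi$ iff $\models\neg\exists G'(\Psi\wedge\neg\mathit{Conseq}_{G\leftarrow G'}[T',\varphi^\pm])$.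
   Context: Propositional logic over alphabet $\Sigma$; $\mathcal{L}_\Sigma$, $\mathit{var}$, $\mathit{Cn}$ as usual; finite sets identified with conjunctions; occurrence polarity as usual (flipped under $\neg$ and in antecedents of $\to$). $\Sigma^\pm=\{p^+,p^-\mid p\in\Sigma\}$ fresh atoms; $\alpha^\pm$ replaces each positive occurrence of $p$ by $p^+$ and each negative one by $\neg p^-$; $W^\pm$ elementwise. Default $\delta=\frac{\alpha:\beta}{\gamma}$, $j(\delta)=\beta$, $c(\delta)=\gamma$. Extensions of $(D,V)$: $E_1=V$, $E_{n+1}=\mathit{Cn}(E_n)\cup\{\gamma\mid\frac{\alpha:\beta}{\gamma}\in D,\alpha\in E_n,\neg\beta\notin E\}$, $E$ extension iff $E=\bigcup_nE_n$. $\delta_p=\frac{\top:p^+\equiv\neg p^-}{(p\equiv p^+)\wedge(\neg p\equiv p^-)}$, $D_\Sigma=\{\delta_p\mid p\in\Sigma\}$. Signed consequence: let $\mathcal{E}$ be the set of extensions of $(D_\Sigma,W^\pm)$ and $\Pi_S=\{c(\delta_p)\mid p\in\Sigma,\neg j(\delta_p)\notin S\}$. $W\vdash^\pm_c\varphi$ iff $\varphi^\pm\in\bigcup_{E\in\mathcal{E}}\mathit{Cn}(W^\pm\cup\Pi_E)$; $W\vdash^\pm_s\varphi$ iff $\varphi^\pm\in\bigcap_{E\in\mathcal{E}}\mathit{Cn}(W^\pm\cup\Pi_E)$; $W\vdash^\pm_p\varphi$ iff $\varphi^\pm\in\mathit{Cn}(W^\pm\cup\bigcap_{E\in\mathcal{E}}\Pi_E)$.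 QBFs with usual semantics; $\models$ means valid. For a finite default theory $(D,V)$ with $D=\{\delta_1,\ldots,\delta_n\}$ and selectors $g_i$: with $\mathcal{C}[T_0,S_0]=\exists P(T_0\wedge\bigwedge_{\psi_k\in S_0}(g_k\to\psi_k))$ ($P$ the non-selector atoms of $T_0\cup S_0$, $\psi_k$ indexed by selector $g_k$), $\mathit{Ext}[(D,V)]=\mathcal{C}[V,j(D)]\wedge\bigwedge_{i=1}^n(\neg g_i\to\neg\mathcal{C}[V\cup\{j(\delta_i)\},j(D\setminus\{\delta_i\})])$, and $\mathit{Conseq}[(D,V),\chi]=\forall P(V\wedge\bigwedge_{i=1}^n(g_i\to c(\delta_i))\to\chi)$ with $P$ the atoms occurring in $(D,V)$ or $\chi$.
   Formalization: Formulas of L_Σ are built from atoms without the constants ⊤ and ⊥ (the ⊤ in δ_p is read as p→p); with constants part (1) fails: for W={⊥}, W ⊢_c φ holds for every φ while Ext[T] is unsatisfiable. *)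

(* Defs.v *)
From HB Require Import structures.
From mathcomp Require Import all_boot.
From mathcomp Require Import boolp classical_sets.
Set Implicit Arguments.
Unset Strict Implicit.
Unset Printing Implicit Defensive.
Local Open Scope classical_set_scope.

(* The language over an alphabet A.  There are no primitive truth constants:
   in L_Sigma they would be untouched by the signing translation and would
   break the satisfiability of signed theories. *)
Inductive form (A : Type) : Type :=
  | Var of A
  | Neg of form A
  | And of form A & form A
  | Or of form A & form A
  | Imp of form A & form A.

HB.instance Definition _ (A : Type) := gen_eqMixin (form A).

Definition Iff (A : Type) (a b : form A) : form A := And (Imp a b) (Imp b a).

(* The constant "true", written with an arbitrary atom x. *)
Definition Top (A : Type) (x : A) : form A := Imp (Var x) (Var x).

Fixpoint eval (A : Type) (v : A -> bool) (a : form A) : bool :=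
  match a with
  | Var x => v x
  | Neg a => ~~ eval v a
  | And a b => eval v a && eval v b
  | Or a b => eval v a || eval v b
  | Imp a b => eval v a ==> eval v b
  end.

Definition Cn (A : Type) (S : set (form A)) : set (form A) :=
  [set a | forall v : A -> bool, (forall b, S b -> eval v b) -> eval v a].

Fixpoint occ (A : Type) (a : form A) : seq A :=
  match a with
  | Var x => [:: x]
  | Neg a => occ a
  | And a b | Or a b | Imp a b => occ a ++ occ b
  end.

Definition var (A : eqType) (a : form A) : seq A := undup (occ a).

Definition vars (A : eqType) (S : seq (form A)) : seq A :=
  undup (flatten [seq occ a | a <- S]).

(* The alphabet Sigma together with its signed copies p^+ and p^-. *)
Inductive satom (Sigma : Type) : Type :=
  | Orig of Sigma
  | Plus of Sigma
  | Minus of Sigma.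

Section SatomEq.
Variable Sigma : Type.
Definition satom_code (x : satom Sigma) : Sigma + (Sigma + Sigma) :=
  match x with
  | Orig p => inl p
  | Plus p => inr (inl p)
  | Minus p => inr (inr p)
  end.
Definition satom_decode (x : Sigma + (Sigma + Sigma)) : satom Sigma :=
  match x with
  | inl p => Orig p
  | inr (inl p) => Plus p
  | inr (inr p) => Minus p
  end.
Lemma satom_codeK : cancel satom_code satom_decode.
Proof. by case. Qed.
End SatomEq.

HB.instance Definition _ (Sigma : eqType) :=
  Equality.copy (satom Sigma) (can_type (@satom_codeK Sigma)).

(* pol is the polarity of the occurrence being translated (true = positive). *)
Fixpoint sign_pol (Sigma : Type) (pol : bool) (a : form Sigma) :
    form (satom Sigma) :=
  match a with
  | Var p => if pol then Var (Plus p) else Neg (Var (Minus p))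
  | Neg a => Neg (sign_pol (~~ pol) a)
  | And a b => And (sign_pol pol a) (sign_pol pol b)
  | Or a b => Or (sign_pol pol a) (sign_pol pol b)
  | Imp a b => Imp (sign_pol (~~ pol) a) (sign_pol pol b)
  end.

Definition sign (Sigma : Type) (a : form Sigma) : form (satom Sigma) :=
  sign_pol true a.

Record default (A : Type) : Type :=
  Default { pre : form A; just : form A; concl : form A }.

(* stage D V E n is E_{n+1} in the usual numbering starting from E_1 = V. *)
Fixpoint stage (A : Type) (D : set (default A)) (V E : set (form A)) (n : nat) :
    set (form A) :=
  if n is m.+1 then
    Cn (stage D V E m) `|`
    [set concl d | d in [set d | [/\ D d, stage D V E m (pre d)
                                   & ~ E (Neg (just d))]]]
  else V.

Definition is_extension (A : Type) (D : set (default A)) (V E : set (form A)) :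
    Prop :=
  E = \bigcup_(n in [set: nat]) stage D V E n.

Definition delta (Sigma : Type) (p : Sigma) : default (satom Sigma) :=
  Default (Top (Orig p))
          (Iff (Var (Plus p)) (Neg (Var (Minus p))))
          (And (Iff (Var (Orig p)) (Var (Plus p)))
               (Iff (Neg (Var (Orig p))) (Var (Minus p)))).

Section SignedConsequence.
Variable Sigma : Type.
Implicit Types (W : set (form Sigma)) (phi : form Sigma).

Definition signed_extensions W : set (set (form (satom Sigma))) :=
  [set E | is_extension (range (@delta Sigma)) (@sign Sigma @` W) E].

Definition Pi (S : set (form (satom Sigma))) : set (form (satom Sigma)) :=
  [set concl (delta p) | p in [set p | ~ S (Neg (just (delta p)))]].

Definition cred_conseq W phi : Prop :=
  (\bigcup_(E in signed_extensions W) Cn (@sign Sigma @` W `|` Pi E))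
    (sign phi).

Definition skep_conseq W phi : Prop :=
  (\bigcap_(E in signed_extensions W) Cn (@sign Sigma @` W `|` Pi E))
    (sign phi).

Definition prud_conseq W phi : Prop :=
  Cn (@sign Sigma @` W `|` \bigcap_(E in signed_extensions W) Pi E)
    (sign phi).

End SignedConsequence.

Inductive qbf (X : Type) : Type :=
  | QVar of X
  | QTop
  | QNeg of qbf X
  | QAnd of qbf X & qbf X
  | QOr of qbf X & qbf X
  | QImp of qbf X & qbf X
  | QEx of X & qbf X
  | QAll of X & qbf X.
Arguments QTop {X}.

Fixpoint qeval (X : eqType) (v : X -> bool) (q : qbf X) : bool :=
  match q with
  | QVar x => v x
  | QTop => true
  | QNeg q => ~~ qeval v q
  | QAnd q r => qeval v q && qeval v r
  | QOr q r => qeval v q || qeval v r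
  | QImp q r => qeval v q ==> qeval v r
  | QEx x q => qeval [eta v with x |-> true] q || qeval [eta v with x |-> false] q
  | QAll x q => qeval [eta v with x |-> true] q && qeval [eta v with x |-> false] q
  end.

Definition qvalid (X : eqType) (q : qbf X) : Prop :=
  forall v : X -> bool, qeval v q.

Definition qconj (X : Type) (s : seq (qbf X)) : qbf X :=
  foldr (@QAnd X) QTop s.

Definition qexists (X : Type) (P : seq X) (q : qbf X) : qbf X :=
  foldr (@QEx X) q P.

Definition qforall (X : Type) (P : seq X) (q : qbf X) : qbf X :=
  foldr (@QAll X) q P.

(* Replacement of each free variable x by f x. *)
Fixpoint qreplace (X : eqType) (f : X -> X) (q : qbf X) : qbf X :=
  match q with
  | QVar x => QVar (f x)
  | QTop => QTop
  | QNeg q => QNeg (qreplace f q)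
  | QAnd q r => QAnd (qreplace f q) (qreplace f r)
  | QOr q r => QOr (qreplace f q) (qreplace f r)
  | QImp q r => QImp (qreplace f q) (qreplace f r)
  | QEx x q => QEx x (qreplace [eta f with x |-> x] q)
  | QAll x q => QAll x (qreplace [eta f with x |-> x] q)
  end.

(* Atoms of A, the selectors g_i (Sel i) and the further variables g'_i
   (Sel' i), enumerate from 0. *)
Inductive qatom (A : Type) : Type :=
  | At of A
  | Sel of nat
  | Sel' of nat.
Arguments Sel {A}.
Arguments Sel' {A}.

Section QatomEq.
Variable A : Type.
Definition qatom_code (x : qatom A) : A + (nat + nat) :=
  match x with
  | At a => inl a
  | Sel i => inr (inl i)
  | Sel' i => inr (inr i)
  end.
Definition qatom_decode (x : A + (nat + nat)) : qatom A :=
  match x with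
  | inl a => At a
  | inr (inl i) => Sel i
  | inr (inr i) => Sel' i
  end.
Lemma qatom_codeK : cancel qatom_code qatom_decode.
Proof. by case. Qed.
End QatomEq.

HB.instance Definition _ (A : eqType) :=
  Equality.copy (qatom A) (can_type (@qatom_codeK A)).

Fixpoint qform (A : Type) (a : form A) : qbf (qatom A) :=
  match a with
  | Var x => QVar (At x)
  | Neg a => QNeg (qform a)
  | And a b => QAnd (qform a) (qform b)
  | Or a b => QOr (qform a) (qform b)
  | Imp a b => QImp (qform a) (qform b)
  end.

Definition qset (A : Type) (S : seq (form A)) : qbf (qatom A) :=
  qconj [seq qform a | a <- S].

(* A finite default theory (D, V); the default at position i of D has
   selector g_i. *)
Definition theory (A : Type) : Type := (seq (default A) * seq (form A))%type.

Section Encodings.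
Variable A : eqType.
Implicit Types (T : theory A) (chi : form A).

Definition enumerate (D : seq (default A)) : seq (nat * default A) :=
  zip (iota 0 (size D)) D.

(* An entry (k, psi) of S0 is the formula psi with selector g_k. *)
Definition Cqbf (T0 : seq (form A)) (S0 : seq (nat * form A)) :
    qbf (qatom A) :=
  qexists [seq At x | x <- vars (T0 ++ [seq s.2 | s <- S0])]
    (QAnd (qset T0)
          (qconj [seq QImp (QVar (Sel s.1)) (qform s.2) | s <- S0])).

Definition Ext T : qbf (qatom A) :=
  let: (D, V) := T in
  QAnd (Cqbf V [seq (k.1, just k.2) | k <- enumerate D])
       (qconj [seq QImp (QNeg (QVar (Sel i.1)))
                        (QNeg (Cqbf (V ++ [:: just i.2])
                                    [seq (k.1, just k.2)
                                    | k <- enumerate D & k.1 != i.1]))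
              | i <- enumerate D]).

Definition theory_vars T chi : seq A :=
  let: (D, V) := T in
  vars (flatten [seq [:: pre d; just d; concl d] | d <- D] ++ V ++ [:: chi]).

Definition Conseq T chi : qbf (qatom A) :=
  let: (D, V) := T in
  qforall [seq At x | x <- theory_vars T chi]
    (QImp (QAnd (qset V)
                (qconj [seq QImp (QVar (Sel i.1)) (qform (concl i.2))
                       | i <- enumerate D]))
          (qform chi)).

Definition prime_sel (x : qatom A) : qatom A :=
  if x is Sel i then Sel' i else x.

Definition Conseq' T chi : qbf (qatom A) := qreplace prime_sel (Conseq T chi).

End Encodings.

(* Main.v *)
Require Import Defs.
From mathcomp Require Import all_boot.
From mathcomp Require Import boolp classical_sets.
Set Implicit Arguments.
Unset Strict Implicit.
Unset Printing Implicit Defensive.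
Local Open Scope classical_set_scope.

(** A signed theory [W^±] does not mention the original atoms, so a default
    [delta p] acts on it only through its justification [p^+ == ~ p^-].  Hence
    the extensions of [(D_Sigma, W^±)] are the sets [Cn (W^± U c(S))] for the
    sets [S] of atoms that are maximal such that [W^±] is consistent with the
    justifications of [S].  Such an [S] contains every atom outside [var(W)],
    so it is coded by an assignment to the selectors, and [Ext] expresses its
    maximality.  Atoms outside [var(W)] and [var(phi)] can be reinterpreted
    freely, which is why [T'] only adds [c(D_phi)].  The prudent case uses
    moreover that some maximal [S] exists, since [W^±] is satisfiable and
    [var(W)] is finite, and that [Conseq] is monotone in the selectors. *)

(** * Propositional evaluation and consequence *)

Section Formulas.
Context {A : eqType}.
Implicit Types (a b : form A) (u v : A -> bool).

Lemma eq_eval u v a : {in occ a, u =1 v} -> eval u a = eval v a.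
Proof.
elim: a => [x|a IHa|a IHa b IHb|a IHa b IHb|a IHa b IHb] /= uv.
- by rewrite uv ?inE.
- by rewrite IHa.
all: by rewrite IHa ?IHb // => x xin; apply: uv; rewrite mem_cat xin ?orbT.
Qed.

Lemma mem_vars (s : seq (form A)) x :
  reflect (exists2 a, a \in s & x \in occ a) (x \in vars s).
Proof. by rewrite mem_undup; apply: flatten_mapP. Qed.

End Formulas.

Lemma CnS (A : Type) (S S' : set (form A)) : S `<=` S' -> Cn S `<=` Cn S'.
Proof. by move=> SS' a Sa v S'v; apply: Sa => b /SS'; apply: S'v. Qed.

(** * Signed formulas and the defaults [delta p] *)

Section SignedFormulas.
Context {Sigma : eqType}.
Implicit Types (a : form Sigma) (u v : satom Sigma -> bool) (p : Sigma).

(** When all atoms are true, [p^+] is true and [~ p^-] is false, and the connectives propagate these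
    values along the polarity. Hence every signed theory is satisfiable. *)
Lemma eval_sign_true b a : eval (fun=> true) (sign_pol b a) = b.
Proof.
elim: a b => [p|a IHa|a IHa c IHc|a IHa c IHc|a IHa c IHc] [] //=;
  by rewrite ?IHa ?IHc.
Qed.

Lemma occ_sign_pol b a x : x \in occ (sign_pol b a) ->
  exists2 p, p \in occ a & x = Plus p \/ x = Minus p.
Proof.
elim: a b => [p|a IHa|a IHa c IHc|a IHa c IHc|a IHa c IHc] b /=.
- by case: b; rewrite inE => /eqP->; exists p; rewrite ?inE; auto.
- exact: IHa.
all: rewrite mem_cat => /orP[/IHa|/IHc] [p pin xp];
  by exists p => //; rewrite mem_cat pin ?orbT.
Qed.

Lemma eq_eval_sign u v a :
    (forall p, p \in occ a -> u (Plus p) = v (Plus p)) ->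
    (forall p, p \in occ a -> u (Minus p) = v (Minus p)) ->
  eval u (sign a) = eval v (sign a).
Proof.
move=> uvP uvM; apply: eq_eval => x /occ_sign_pol[p pin [->|->]].
  exact: uvP.
exact: uvM.
Qed.

Lemma eval_just u p :
  eval u (just (delta p)) = (u (Plus p) == ~~ u (Minus p)).
Proof. by rewrite /=; case: (u _) (u _) => [] []. Qed.

Lemma eval_concl u p :
  eval u (concl (delta p)) =
    (u (Orig p) == u (Plus p)) && (u (Plus p) == ~~ u (Minus p)).
Proof. by rewrite /=; case: (u _) (u _) (u _) => [] [] []. Qed.

Lemma concl_delta_inj : injective (fun p => concl (delta p)).
Proof. by move=> p q []. Qed.

End SignedFormulas.

(** * Extensions as maximal consistent sets of atoms *)

Section Extensions.
Context {Sigma : eqType}.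
Variable W : seq (form Sigma).
Implicit Types (S : set Sigma) (u : satom Sigma -> bool) (p q : Sigma).
Implicit Types (E : set (form (satom Sigma))).

Local Notation V := (@sign Sigma @` [set` W]).

Definition concls S : set (form (satom Sigma)) :=
  [set concl (delta p) | p in S].

Definition theory_model u := forall a, a \in W -> eval u (sign a).

Definition agree_on S u := forall p, S p -> eval u (just (delta p)).

Definition consistent_with S := exists u, theory_model u /\ agree_on S u.

Definition maximal_consistent S :=
  consistent_with S /\ forall q, consistent_with (q |` S) -> S q.

Lemma concls_model S u :
  (forall b, (V `|` concls S) b -> eval u b) <->
  theory_model u /\ forall p, S p -> eval u (concl (delta p)).
Proof.
split=> [Hu|[Wu Su] b [[a aW <-]|[p Sp <-]]]; [|exact: Wu|exact: Su].
by split=> [a aW|p Sp]; apply: Hu; [left; exists a|right; exists p].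
Qed.

(* All defaults of [D_Sigma] have a tautological prerequisite, so every
   applicable one fires at the second stage. *)
Lemma signed_extensionP E :
  signed_extensions [set` W] E <-> E = Cn (V `|` Pi E).
Proof.
rewrite /signed_extensions /= /is_extension.
suff -> : \bigcup_(n in [set: nat]) stage (range (@delta Sigma)) V E n
          = Cn (V `|` Pi E) by [].
apply/seteqP; split=> a.
  case=> n _; elim: n a => [|n IHn] a.
    by move=> Va u; apply; left.
  case=> [Ca u Hu|[d [[p _ <-] _ NE] <-]].
    by apply: Ca => b /IHn; apply.
  by move=> u; apply; right; exists p.
(* Stage 1 contains the tautological prerequisites, stage 2 contains [V] and the fired conclusions,
   and stage 3 closes these under consequence. *)
move=> Ca; exists 3 => //; left; apply: CnS Ca => b [Vb|[p NE <-]].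
  by left=> u; apply; left=> v; apply.
right; exists (delta p) => //; split=> //.
by left=> u _ /=; rewrite implybb.
Qed.

(** Neither [W^±] nor the justifications mention original atoms, so each [p] may be given the value
    of [p^+]; this turns a true justification into a true conclusion. *)
Lemma consistent_concls S : consistent_with S ->
  exists u, [/\ theory_model u, agree_on S u
              & forall p, S p -> eval u (concl (delta p))].
Proof.
case=> u [Wu Su].
pose u' x := if x is Orig p then u (Plus p) else u x.
exists u'; split=> [a aW|p Sp|p Sp].
- by rewrite (eq_eval_sign (v := u)) //; apply: Wu.
- by have := Su p Sp; rewrite !eval_just.
- by have := Su p Sp; rewrite eval_just eval_concl eqxx.
Qed.

Lemma agree_onS S S' u : S `<=` S' -> agree_on S' u -> agree_on S u.
Proof. by move=> SS' Su p /SS'; apply: Su. Qed.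

Lemma consistent_withS S S' :
  S `<=` S' -> consistent_with S' -> consistent_with S.
Proof. by move=> SS' [u [Wu Su]]; exists u; split=> //; apply: agree_onS Su. Qed.

(** A conclusion entails its justification, so models of the premises agree on [S]; conversely
    [consistent_concls] upgrades justifications to conclusions without losing [W^±]. *)
Lemma Cn_neg_just S q :
  Cn (V `|` concls S) (Neg (just (delta q))) <-> ~ consistent_with (q |` S).
Proof.
split=> [Cq [u [Wu Su]]|NC u /concls_model[Wu Su]].
  case: (consistent_concls (ex_intro _ u (conj Wu Su))) => w [Ww jw cw].
  have Hw : forall b, (V `|` concls S) b -> eval w b.
    by apply/concls_model; split=> // p Sp; apply: cw; right.
  have /negP : ~~ eval w (just (delta q)) := Cq w Hw.
  by apply; apply: jw; left.
apply/negP => uq; apply: NC; exists u; split=> // p [->//|/Su].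
by rewrite eval_concl eval_just => /andP[].
Qed.

Lemma consistent_with0 : consistent_with set0.
Proof.
by exists (fun=> true); split=> // a _; apply: eval_sign_true.
Qed.

(** For an atom outside [W], making [p^+] true and [p^-] false satisfies its justification and
    leaves [W^±] unaffected. *)
Lemma consistent_with_fresh S : consistent_with S ->
  consistent_with (S `|` [set p | p \notin vars W]).
Proof.
case=> u [Wu Su].
pose u' (x : satom Sigma) := match x with
  | Orig p => u x
  | Plus p => (p \notin vars W) || u x
  | Minus p => (p \in vars W) && u x
  end.
exists u'; split=> [a aW|p pS].
  have aX p : p \in occ a -> p \in vars W by move=> pa; apply/mem_vars; exists a.
  by rewrite (eq_eval_sign (v := u)) => [|p /aX pW|p /aX pW];
    rewrite ?Wu // /u' pW.
rewrite eval_just /u'; have [pW/=|//] := boolP (p \in vars W).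
by case: pS => [/Su|/=]; rewrite ?eval_just // pW.
Qed.

Lemma maximal_fresh S p : maximal_consistent S -> p \notin vars W -> S p.
Proof.
move=> [CS maxS] pW; apply: maxS.
by apply: consistent_withS (consistent_with_fresh CS) => q [->|]; [right|left].
Qed.

Lemma extension_maximal E : signed_extensions [set` W] E ->
  exists2 S, maximal_consistent S & Pi E = concls S.
Proof.
move=> /signed_extensionP defE.
pose S := [set p | ~ E (Neg (just (delta p)))].
have PiE : Pi E = concls S by [].
have memS q : S q <-> consistent_with (q |` S).
  rewrite /S /= {1}defE PiE Cn_neg_just; split=> [/contrapT//|Cq]; exact.
exists S => //; split=> [|q /memS//].
(* [memS] yields consistency of [S] only through one of its members; an empty [S] is handled by
   satisfiability of [W^±]. *)
have [[q Sq]|S0] := pselect (exists q, S q).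
  by apply: consistent_withS (proj1 (memS q) Sq) => p; right.
by apply: consistent_withS consistent_with0 => p Sp; apply: S0; exists p.
Qed.

(** Maximality means that the closure of [W^±] and the conclusions of [S] refutes exactly the
    justifications outside [S], so this closure is a fixed point. *)
Lemma maximal_extension S : maximal_consistent S ->
  exists2 E, signed_extensions [set` W] E & Pi E = concls S.
Proof.
move=> [CS maxS]; pose E := Cn (V `|` concls S).
suff PiE : Pi E = concls S.
  by exists E => //; apply/signed_extensionP; rewrite PiE.
congr image; apply/seteqP; split=> p.
  by move=> NEp; apply: maxS; apply: contrapT => /Cn_neg_just.
move=> Sp /Cn_neg_just; apply.
by apply: consistent_withS CS => q [->|].
Qed.

(** Greedy extension along [s]: an atom rejected once stays rejected, because consistency passes to
    subsets. *)
Lemma consistent_extend (s : seq Sigma) S : consistent_with S ->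
  exists S', [/\ S `<=` S', consistent_with S' &
    forall q, q \in s -> consistent_with (q |` S') -> S' q].
Proof.
elim: s S => [|p s IHs] S CS; first by exists S; split.
have [CpS|NCpS] := pselect (consistent_with (p |` S)).
  have [S' [SS' CS' maxS']] := IHs _ CpS; exists S'; split=> //.
    by move=> q Sq; apply: SS'; right.
  move=> q; rewrite inE => /orP[/eqP-> _|]; last exact: maxS'.
  by apply: SS'; left.
have [S' [SS' CS' maxS']] := IHs _ CS; exists S'; split=> // q.
rewrite inE => /orP[/eqP->|]; last exact: maxS'.
move=> CpS'; case: NCpS; apply: consistent_withS CpS' => r [->|/SS'].
  by left.
by right.
Qed.

Lemma maximal_exists : exists S, maximal_consistent S.
Proof.
(* Starting with all atoms outside [W] leaves only the finite list [vars W] to decide. *)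
have [S [SS' CS maxS]] :=
  @consistent_extend (vars W) _ (consistent_with_fresh consistent_with0).
exists S; split=> // q; have [|qW _] := boolP (q \in vars W).
  exact: maxS.
by apply: SS'; right.
Qed.

Lemma cred_conseqE phi : cred_conseq [set` W] phi <->
  exists2 S, maximal_consistent S & Cn (V `|` concls S) (sign phi).
Proof.
split=> [[E /extension_maximal[S maxS ->]]|[S /maximal_extension[E extE <-]]].
  by exists S.
by exists E.
Qed.

Lemma skep_conseqE phi : skep_conseq [set` W] phi <->
  forall S, maximal_consistent S -> Cn (V `|` concls S) (sign phi).
Proof.
split=> [H S /maximal_extension[E extE <-]|H E /extension_maximal[S maxS ->]].
  exact: H.
exact: H.
Qed.

Lemma prud_conseqE phi : prud_conseq [set` W] phi <->
  Cn (V `|` concls [set p | forall S, maximal_consistent S -> S p]) (sign phi).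
Proof.
rewrite /prud_conseq; suff -> : \bigcap_(E in signed_extensions [set` W]) Pi E =
  concls [set p | forall S, maximal_consistent S -> S p] by [].
apply/seteqP; split=> b.
  (* Some extension is needed to see that [b] is a conclusion at all; injectivity of [c(delta p)]
     then gives the same atom [p] in every maximal set. *)
  move=> Hb; have [S0 /maximal_extension[E0 extE0 PiE0]] := maximal_exists.
  have := Hb E0 extE0; rewrite PiE0 => -[p _ defb]; exists p => // S maxS.
  have [E extE PiE] := maximal_extension maxS.
  have := Hb E extE; rewrite PiE -defb => -[q Sq].
  by move/concl_delta_inj <-.
move=> [p Hp <-] E /extension_maximal[S maxS ->].
by exists p => //; apply: Hp.
Qed.

(** A model of [W^±] and the conclusions of [S] that also satisfies [c(delta p)] witnesses that [p]
    can be added to [S], so maximality applies. *)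
Lemma Cn_concl S p : maximal_consistent S ->
  Cn (V `|` concls S) (concl (delta p)) <-> S p.
Proof.
move=> [CS maxS]; split=> [Cp|Sp u]; last by apply; right; exists p.
have [u [Wu Su cu]] := consistent_concls CS.
apply: maxS; exists u; split=> // q [->|]; last exact: Su.
have : eval u (concl (delta p)) by apply: Cp; apply/concls_model.
by rewrite eval_concl eval_just => /andP[].
Qed.

End Extensions.

(** * Blocks of QBF quantifiers *)

Section Quantifiers.
Context {X : eqType}.
Implicit Types (v : X -> bool) (P : seq X) (q : qbf X).

Lemma qexistsP v P q :
  reflect (exists v', {in predC (mem P), v' =1 v} /\ qeval v' q)
          (qeval v (qexists P q)).
Proof.
apply: (iffP idP).
  elim: P v => [|x P IHP] v /=; first by exists v.
  by case/orP => /IHP[v' [Hv' qv']]; exists v'; split=> // y;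
    rewrite !inE negb_or => /andP[yx yP]; rewrite Hv' ?inE //= (negPf yx).
elim: P v => [|x P IHP] v /= [v' [Hv' qv']].
  by have <- : v' = v by apply/funext => y; apply: Hv'.
(* The disjunct to prove is the one given by the value of [v'] at [x]. *)
apply/orP; have H b : v' x = b -> qeval [eta v with x |-> b] (qexists P q).
  move=> vx; apply: IHP; exists v'; split=> // y; rewrite inE => yP /=.
  by case: eqP => [->//|/eqP yx]; apply: Hv'; rewrite !inE negb_or yx.
by case: (v' x) H => H; [left|right]; apply: H.
Qed.

Lemma qeval_forall v P q :
  qeval v (qforall P q) = ~~ qeval v (qexists P (QNeg q)).
Proof.
elim: P v => [|x P IHP] v /=; first by rewrite negbK.
by rewrite !IHP negb_or.
Qed.

Lemma qforallP v P q :
  (forall v', {in predC (mem P), v' =1 v} -> qeval v' q) <->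
  qeval v (qforall P q).
Proof.
rewrite qeval_forall; split=> [H|/qexistsP H v' Hv'].
  by apply/qexistsP => -[v' [/H qv']] /=; rewrite qv'.
by apply: contrapT => /negP nq; apply: H; exists v'.
Qed.

Lemma qeval_conj (I : Type) v (F : I -> qbf X) (s : seq I) :
  qeval v (qconj [seq F i | i <- s]) = all (fun i => qeval v (F i)) s.
Proof. by elim: s => //= i s ->. Qed.

End Quantifiers.

(** * Semantics of [Cqbf], [Conseq] and [Conseq'] *)

Section EncodingSemantics.
Context {A : eqType}.
Implicit Types (v : qatom A -> bool) (u : A -> bool) (a : form A).
Implicit Types (X : seq A) (s : seq (form A)).

Lemma qeval_form v a : qeval v (qform a) = eval (fun x => v (At x)) a.
Proof. by elim: a => //= [a ->|a -> b ->|a -> b ->|a -> b ->]. Qed.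

Lemma qeval_set v s : qeval v (qset s) = all (eval (fun x => v (At x))) s.
Proof. by rewrite qeval_conj; apply: eq_all => a; apply: qeval_form. Qed.

(** The witness for a quantifier block over [X]: selectors keep their value from [v], while formulas
    over [X] are evaluated as by [u]. *)
Definition override X u v (x : qatom A) : bool :=
  if x is At y then if y \in X then u y else v x else v x.

Lemma override_out X u v :
  {in predC (mem [seq At x | x <- X]), override X u v =1 v}.
Proof.
move=> [x|i|i] //= xX; case: ifP => // xin; case/negP: xX.
exact: (map_f (@At A)).
Qed.

Lemma eval_override X u v a : {subset occ a <= X} ->
  eval (fun x => override X u v (At x)) a = eval u a.
Proof. by move=> aX; apply: eq_eval => x /aX /= ->. Qed.

(** Abstracts over [Sel] and [Sel'], so that [Conseq] and its renamed form are analysed once. *)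
Definition is_selector (c : nat -> qatom A) :=
  injective c /\ forall i x, c i <> At x.

Lemma Sel_selector : is_selector Sel.
Proof. by split=> // i j []. Qed.

Lemma Sel'_selector : is_selector Sel'.
Proof. by split=> // i j []. Qed.

Lemma selector_fixed c X v v' i : is_selector c ->
    {in predC (mem [seq At x | x <- X]), v' =1 v} ->
  v' (c i) = v (c i).
Proof. by move=> [_ cA] Hv; apply: Hv; rewrite inE; apply/mapP => -[x _ /cA]. Qed.

(** The quantified block covers all atoms of the formulas and no selector. Selector numbers come
    from a separate [k] because [Ext] also uses filtered lists that keep the original numbering. *)
Lemma qeval_C (I : eqType) v s (r : seq I) (k : I -> nat) (f : I -> form A) :
  qeval v (Cqbf s [seq (k i, f i) | i <- r]) <->
  exists u, {in s, forall a, eval u a} /\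
            {in r, forall i, v (Sel (k i)) -> eval u (f i)}.
Proof.
rewrite /Cqbf -!map_comp /=; set X := vars _.
have sX a : a \in s -> {subset occ a <= X}.
  by move=> ain x xin; apply/mem_vars; exists a; rewrite ?mem_cat ?ain.
have rX i : i \in r -> {subset occ (f i) <= X}.
  move=> ir x xin; apply/mem_vars; exists (f i) => //.
  by rewrite mem_cat (map_f (fun i => f i)) ?orbT.
split=> [/qexistsP[v' [Hv' /=]]|[u [su ru]]].
  rewrite qeval_set qeval_conj => /andP[/allP sv' /allP rv'].
  exists (fun x => v' (At x)); split=> // i ir.
  have /= := rv' i ir; rewrite (selector_fixed _ Sel_selector Hv') qeval_form.
  by move/implyP.
apply/qexistsP; exists (override X u v); split; first exact: override_out.
rewrite /= qeval_set qeval_conj; apply/andP; split; apply/allP => i ir /=.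
  by rewrite eval_override ?su //; apply: sX.
by apply/implyP => /(ru _ ir); rewrite qeval_form eval_override //; apply: rX.
Qed.

Definition conseq_with (c : nat -> qatom A) (T : theory A) (chi : form A) :
    qbf (qatom A) :=
  qforall [seq At x | x <- theory_vars T chi]
    (QImp (QAnd (qset T.2)
                (qconj [seq QImp (QVar (c i.1)) (qform (concl i.2))
                       | i <- enumerate T.1]))
          (qform chi)).

Lemma ConseqE (T : theory A) chi : Conseq T chi = conseq_with Sel T chi.
Proof. by case: T. Qed.

Lemma qreplace_form a : qreplace (@prime_sel A) (qform a) = qform a.
Proof. by elim: a => //= [a ->|a -> b ->|a -> b ->|a -> b ->]. Qed.

Lemma qreplace_conj (Y : eqType) (f : Y -> Y) (s : seq (qbf Y)) :
  qreplace f (qconj s) = qconj [seq qreplace f q | q <- s].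
Proof. by elim: s => //= q s ->. Qed.

Lemma qreplace_forall X q :
  qreplace (@prime_sel A) (qforall [seq At x | x <- X] q) =
  qforall [seq At x | x <- X] (qreplace (@prime_sel A) q).
Proof.
elim: X => //= x X <-; congr QAll.
(* Bound variables are plain atoms, which [prime_sel] already fixes, so protecting them under the
   binder changes nothing. *)
by congr qreplace; apply/funext => y /=; case: eqP => // ->.
Qed.

Lemma Conseq'E (T : theory A) chi : Conseq' T chi = conseq_with Sel' T chi.
Proof.
rewrite /Conseq' ConseqE qreplace_forall /= qreplace_form /qset.
rewrite !qreplace_conj -!map_comp.
congr (qforall _ (QImp (QAnd (qconj _) (qconj _)) _)); apply: eq_map.
  by move=> a /=; rewrite qreplace_form.
by move=> i /=; rewrite qreplace_form.
Qed.

(** Without repetitions a position is the index of its element, so the selector of [delta p] can be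
    addressed through [p]. *)
Lemma enumerate_map (I : eqType) (f : I -> default A) (r : seq I) : uniq r ->
  enumerate [seq f i | i <- r] = [seq (index i r, f i) | i <- r].
Proof.
move=> ur; rewrite /enumerate size_map.
have <- : [seq index i r | i <- r] = iota 0 (size r).
  case: r ur => // i0 r ur; apply: (@eq_from_nth _ 0) => [|j].
    by rewrite size_map size_iota.
  rewrite size_map => jr.
  by rewrite nth_iota // (nth_map i0) // index_uniq.
by rewrite -zip_map.
Qed.

Lemma qeval_conseq (I : eqType) c v s (r : seq I) (f : I -> default A) chi :
    is_selector c -> uniq r ->
  qeval v (conseq_with c ([seq f i | i <- r], s) chi) <->
  forall u, {in s, forall a, eval u a} ->
    {in r, forall i, v (c (index i r)) -> eval u (concl (f i))} -> eval u chi.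
Proof.
move=> cs ur; rewrite /conseq_with /= enumerate_map // -!map_comp.
set X := vars _.
have sX a : a \in s -> {subset occ a <= X}.
  by move=> ain x xin; apply/mem_vars; exists a; rewrite // !mem_cat ain orbT.
have chiX : {subset occ chi <= X}.
  by move=> x xin; apply/mem_vars; exists chi; rewrite // !mem_cat inE eqxx !orbT.
have rX i : i \in r -> {subset occ (concl (f i)) <= X}.
  move=> ir x xin; apply/mem_vars; exists (concl (f i)) => //.
  rewrite mem_cat; apply/orP; left.
  by apply/flatten_mapP; exists i; rewrite //= !inE eqxx !orbT.
split=> [/qforallP H u su ru|H].
  have := H _ (@override_out X u v).
  rewrite /= qeval_form eval_override // => /implyP; apply.
  rewrite qeval_set qeval_conj; apply/andP; split; apply/allP => i ir /=.
    by rewrite eval_override ?su //; apply: sX.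
  rewrite (selector_fixed _ cs (@override_out X u v)).
  by apply/implyP => /(ru _ ir); rewrite qeval_form eval_override //; apply: rX.
apply/qforallP => v' Hv' /=; rewrite qeval_set qeval_conj qeval_form.
apply/implyP => /andP[/allP sv' /allP rv']; apply: H => // i ir.
by have /= := rv' i ir; rewrite (selector_fixed _ cs Hv') qeval_form => /implyP.
Qed.

End EncodingSemantics.

(** * Selector assignments as sets of atoms *)

Section SelectedAtoms.
Context {Sigma : eqType}.
Variable W : seq (form Sigma).
Implicit Types (S : set Sigma) (v : qatom (satom Sigma) -> bool).
Implicit Types (c : nat -> qatom (satom Sigma)) (p q : Sigma).

Local Notation X := (vars W).
Local Notation V := (@sign Sigma @` [set` W]).
Local Notation DW := [seq delta p | p <- vars W].
Local Notation VW := [seq sign a | a <- W].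

Lemma uniq_vars : uniq X. Proof. exact: undup_uniq. Qed.

(** The implication puts every atom outside [W] into the set, as maximality demands. *)
Definition selected c v : set Sigma := [set p | p \in X -> v (c (index p X))].

Lemma in_signedW u :
  {in VW, forall a, eval u a} <-> theory_model W u.
Proof.
split=> [H a aW|H _ /mapP[a aW ->]]; last exact: H.
by apply: H; apply: map_f.
Qed.

(** The first conjunct of [Ext] is consistency of the selected atoms ([C1]); the others say that no
    unselected atom of [W] can be added ([C2]). *)
Lemma ExtP v : qeval v (Ext (DW, VW)) <-> maximal_consistent W (selected Sel v).
Proof.
rewrite /Ext (enumerate_map _ uniq_vars) -!map_comp.
pose sel p := v (Sel (index p X)).
have C1 : qeval v (Cqbf VW [seq (index p X, just (delta p)) | p <- X]) <->
          consistent_with W (selected Sel v).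
  rewrite (qeval_C _ _ _ (fun p => index p X) (fun p => just (delta p))).
  split=> [[u [/in_signedW Wu ru]]|[u [Wu Su]]]; last first.
    by exists u; split=> [|p pX vp]; [apply/in_signedW|apply: Su => _].
  (* The QBF constrains only atoms of [W]; those outside are added by [consistent_with_fresh]. *)
  have C : consistent_with W [set p | p \in X /\ sel p].
    by exists u; split=> // p [pX vp]; apply: ru.
  apply: consistent_withS (consistent_with_fresh C) => p Sp /=.
  by have [pX|pX] := boolP (p \in X); [left; split=> //; apply: Sp|right].
have C2 q : q \in X -> ~~ sel q ->
    qeval v (Cqbf (VW ++ [:: just (delta q)])
                [seq (index p X, just (delta p)) | p <- X & p != q]) <->
    consistent_with W (q |` selected Sel v).
  move=> qX Nq.
  rewrite (qeval_C _ _ _ (fun p => index p X) (fun p => just (delta p))).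
  split=> [[u [Wu ru]]|[u [Wu Su]]]; last first.
    exists u; split=> [a|p].
      rewrite mem_cat => /orP[|]; first by apply/in_signedW: a.
      by rewrite inE => /eqP->; apply: Su; left.
    by rewrite mem_filter => /andP[_ pX] vp; apply: Su; right.
  have C : consistent_with W (q |` [set p | p \in X /\ sel p]).
    exists u; split=> [|p [->|[pX vp]]].
    - by apply/in_signedW => a aV; apply: Wu; rewrite mem_cat aV.
    - by apply: Wu; rewrite mem_cat inE eqxx orbT.
    (* Removing [q] from the list loses no selected atom, as [q] is unselected. *)
    - apply: ru => //; rewrite mem_filter pX andbT.
      by apply: contraNneq Nq => <-.
  apply: consistent_withS (consistent_with_fresh C) => p [->|Sp] /=.
    by left; left.
  by have [pX|pX] := boolP (p \in X); [left; right; split=> //; apply: Sp|right].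
have filt q : q \in X ->
    [seq (k.1, just k.2) | k <- [seq (index p X, delta p) | p <- X]
                         & k.1 != index q X] =
    [seq (index p X, just (delta p)) | p <- X & p != q].
  move=> qX; rewrite filter_map -map_comp; congr map; apply: eq_in_filter => p pX.
  by rewrite /= (inj_in_eq (index_inj p (s := X))).
rewrite /= qeval_conj; split.
  case/andP => /C1 CS /allP HN; split=> // q Cq qX.
  apply: contraT => Nq; have /= := HN q qX.
  by rewrite filt // => /implyP/(_ Nq)/negP[]; apply/C2.
move=> [/C1 CS maxS]; apply/andP; split=> //; apply/allP => q qX /=.
rewrite filt //; apply/implyP => Nq; apply/negP => /(C2 q qX Nq)/maxS/(_ qX) Sq.
by rewrite Sq in Nq.
Qed.

(** The two premise sets differ only in conclusions for atoms outside [W] and [phi], which can be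
    made true without affecting [W^±] or [phi^±]. *)
Lemma conseq_signP c v phi : is_selector c ->
  qeval v (conseq_with c (DW, VW ++ [seq concl d | d <-
                [seq delta p | p <- var phi & p \notin X]]) (sign phi)) <->
  Cn (V `|` concls (selected c v)) (sign phi).
Proof.
move=> cs; rewrite (qeval_conseq _ _ _ _ cs uniq_vars) -map_comp.
split=> [H u /concls_model[Wu Su]|H u Hu ru].
  apply: H => [a|p pX vp]; last by apply: Su.
  rewrite mem_cat => /orP[|/mapP[p]]; first by apply/in_signedW: a.
  by rewrite mem_filter => /andP[/negP pX _] -> /=; apply: Su.
pose K := X ++ var phi.
(* Outside [K], [p] and [p^+] become true and [p^-] false, which satisfies [c(delta p)]. *)
pose u' (x : satom Sigma) := match x with
  | Orig p | Plus p => (p \in K) ==> u x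
  | Minus p => (p \in K) && u x
  end.
have phiK p : p \in occ phi -> p \in K.
  by move=> pin; rewrite mem_cat [p \in var _]mem_undup pin orbT.
rewrite -(eq_eval_sign (u := u')) => [|p /phiK pK|p /phiK pK];
  rewrite ?/u' /= ?pK //.
apply: H; apply/concls_model; split=> [a aW|p Sp].
  have aK p : p \in occ a -> p \in K.
    by move=> pin; rewrite mem_cat; apply/orP; left; apply/mem_vars; exists a.
  rewrite (eq_eval_sign (v := u)) => [|p /aK pK|p /aK pK]; rewrite ?/u' /= ?pK //.
  by apply: Hu; rewrite mem_cat map_f.
rewrite eval_concl /u'; have [pK|//] := boolP (p \in K).
rewrite /= -eval_concl.
(* Conclusions for atoms of [W] come from their selectors, those for the remaining atoms of [phi]
   from [c(D_phi)]. *)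
have [pX|pX] := boolP (p \in X); first by apply: ru => //; apply: Sp.
apply: Hu; rewrite mem_cat; apply/orP; right; apply/mapP; exists p => //.
by move: pK; rewrite mem_filter pX mem_cat (negPf pX).
Qed.

(** Under a maximal selection, [Cn_concl] reduces the [Conseq] test inside [Psi] to membership. *)
Lemma Conseq_conclP v q : q \in X -> maximal_consistent W (selected Sel v) ->
  qeval v (Conseq (DW, VW) (concl (delta q))) <-> selected Sel v q.
Proof.
move=> qX maxS; rewrite ConseqE (qeval_conseq _ _ _ _ Sel_selector uniq_vars).
split=> [H|Sq u _ ru]; last by apply: ru => //; apply: Sq.
apply/(Cn_concl q maxS) => u /concls_model[Wu Su].
by apply: H => [|p pX vp]; [apply/in_signedW|apply: Su].
Qed.

Lemma selected_surj c v S : is_selector c -> (forall p, p \notin X -> S p) ->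
  exists v', {in predC (mem [seq c i | i <- iota 0 (size DW)]), v' =1 v} /\
             selected c v' = S.
Proof.
move=> [cI _] XS; rewrite size_map; set G := map _ _.
(* Each selector is decoded to its atom, which is unique since [c] and the index are injective on
   [X]. *)
exists (fun x => if x \in G
                 then `[< forall p, p \in X -> x = c (index p X) -> S p >]
                 else v x); split=> [x|].
  by rewrite !inE => /negPf->.
have cG p : p \in X -> c (index p X) \in G.
  by move=> pX; rewrite map_f // mem_iota index_mem.
apply/seteqP; split=> p Sp.
  have [pX|] := boolP (p \in X); last exact: XS.
  by have := Sp pX; rewrite cG // => /asboolP; apply.
move=> pX; rewrite cG //; apply/asboolP => q qX /cI.
by move/(index_inj p pX qX) <-.
Qed.

Lemma exists_extP v (q : qbf (qatom (satom Sigma))) :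
  qeval v (qexists [seq Sel i | i <- iota 0 (size DW)]
             (QAnd (Ext (DW, VW)) q)) <->
  exists v', [/\ {in predC (mem [seq Sel i | i <- iota 0 (size DW)]), v' =1 v},
                 maximal_consistent W (selected Sel v') & qeval v' q].
Proof.
split=> [/qexistsP[v' [Hv' /andP[/ExtP maxS qv']]]|[v' [Hv' /ExtP maxS qv']]].
  by exists v'.
by apply/qexistsP; exists v'; split=> //; apply/andP.
Qed.

Lemma exists_not_conclP v p : p \in X ->
  qeval v (qexists [seq Sel i | i <- iota 0 (size DW)]
    (QAnd (Ext (DW, VW)) (QNeg (Conseq (DW, VW) (concl (delta p)))))) <->
  exists2 S, maximal_consistent W S & ~ S p.
Proof.
move=> pX; rewrite exists_extP; split=> [[v' [_ maxS /negP NC]]|[S maxS Sp]].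
  by exists (selected Sel v') => // Sp; apply: NC; apply/Conseq_conclP.
have [v' [Hv' defS]] :=
  selected_surj v Sel_selector (fun p => maximal_fresh maxS).
exists v'; split; rewrite ?defS //=.
by apply/negP => /(Conseq_conclP pX); rewrite defS => /(_ maxS).
Qed.

End SelectedAtoms.

(** * The three QBF characterizations *)

Unset Implicit Arguments.

Theorem theorem8 (Sigma : eqType) (W : seq (form Sigma)) (phi : form Sigma) :
  let D_W := [seq delta p | p <- vars W] in
  let D_phi := [seq delta p | p <- var phi & p \notin vars W] in
  let T := (D_W, [seq sign a | a <- W]) in
  let T' := (D_W, [seq sign a | a <- W] ++ [seq concl d | d <- D_phi]) in
  let n := size D_W in
  let G := [seq Sel i | i <- iota 0 n] in
  let G' := [seq Sel' i | i <- iota 0 n] in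
  let Psi :=
    qconj [seq QImp (QNeg (QVar (Sel' i.1)))
                    (qexists G (QAnd (Ext T) (QNeg (Conseq T (concl i.2)))))
          | i <- enumerate D_W] in
  [/\ cred_conseq [set` W] phi <->
        qvalid (qexists G (QAnd (Ext T) (Conseq T' (sign phi)))),
      skep_conseq [set` W] phi <->
        qvalid (QNeg (qexists G (QAnd (Ext T) (QNeg (Conseq T' (sign phi))))))
    & prud_conseq [set` W] phi <->
        qvalid (QNeg (qexists G' (QAnd Psi (QNeg (Conseq' T' (sign phi))))))].
Proof.
move=> D_W D_phi T T' n G G' Psi.
have ConseqP v : qeval v (Conseq T' (sign phi)) <-> _ :=
  conseq_signP W v phi Sel_selector.
have Conseq'P v : qeval v (conseq_with Sel' T' (sign phi)) <-> _ :=
  conseq_signP W v phi Sel'_selector.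
have fresh S : maximal_consistent W S -> forall p, p \notin vars W -> S p.
  by move=> maxS p; apply: maximal_fresh.
split.
(* Here and below, [xpredT] is an arbitrary assignment at which validity is instantiated. *)
- rewrite cred_conseqE; split=> [[S maxS CS] v|/(_ xpredT)].
    have [v' [Hv' defS]] := selected_surj v Sel_selector (fresh S maxS).
    apply/exists_extP; exists v'; rewrite defS; split=> //.
    by apply/ConseqP; rewrite defS.
  by case/exists_extP => v' [_ maxS /ConseqP CS]; exists (selected W Sel v').
- rewrite skep_conseqE; split=> [H v|H S maxS].
    apply/negP => /exists_extP[v' [_ maxS /negP NC]].
    by apply: NC; apply/ConseqP; apply: H.
  have [v' [Hv' defS]] := selected_surj xpredT Sel_selector (fresh S maxS).
  apply: contrapT => NC; apply/negP: (H xpredT).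
  apply/negPn/exists_extP; exists v'; rewrite defS; split=> //.
  by apply/negP => /ConseqP; rewrite defS.
pose core := [set p | forall S, maximal_consistent W S -> S p].
(* [Psi] forces an atom to be selected unless some maximal set omits it, so it bounds the selection
   from below by [core] without fixing it. *)
have PsiP v : qeval v Psi <-> core `<=` selected W Sel' v.
  rewrite /Psi (enumerate_map _ (uniq_vars W)) -map_comp qeval_conj.
  split=> [/allP H p Hp pW|H].
    apply: contraT => Np; have /implyP/(_ Np) := H p pW.
    by case/(exists_not_conclP v pW) => S /Hp.
  apply/allP => p pW; apply/implyP => Np; apply/(exists_not_conclP v pW).
  apply: contrapT => NS; move/negP: Np; apply; apply: (H p) => // S maxS.
  by apply: contrapT => Sp; apply: NS; exists S.
rewrite prud_conseqE Conseq'E; split=> [H v|H].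
  (* A selection larger than [core] only adds premises, so the consequence persists. *)
  apply/negP => /qexistsP[v' [_ /andP[/PsiP sub /negP]]]; apply.
  apply/Conseq'P; apply: CnS H => a [Wa|[p Hp <-]]; first by left.
  by right; exists p => //; apply: sub.
have coreX p : p \notin vars W -> core p by move=> pW S /fresh; apply.
(* Selecting exactly [core] satisfies [Psi] with the fewest premises, so a failure of prudent
   consequence shows up there. *)
have [v' [Hv' defS]] := selected_surj xpredT Sel'_selector coreX.
apply: contrapT => NC; move/negP: (H xpredT); apply.
apply/qexistsP; exists v'; split=> //; apply/andP; split.
  by apply/PsiP; rewrite defS.
by apply/negP => /Conseq'P; rewrite defS.
Qed.
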